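(* Let $\mathcal{K}\subseteq\mathbb{Z}_N$ be an $(N,K,\lambda)$ difference set, let $v=\frac{1}{\sqrt{K}}\chi_{\mathcal{K}}\in\mathbb{C}^N$, and for $i=0,\dots,N-1$ let $\mathcal{W}_i=\operatorname{span}\{M_jT_iv\}_{j=0}^{N-1}\subseteq\mathbb{C}^N$. Let $\mathcal{FF}(N,K,N)$ be the class of tight fusion frames in $\mathbb{C}^N$ consisting of $N$ subspaces, each of dimension $K$. Then the Gabor fusion frame $\{\mathcal{W}_i\}_{i=0}^{N-1}$ associated with $\mathcal{K}$ is an optimally sparse fusion frame in the class $\mathcal{FF}(N,K,N)$ with respect to the canonical basis of $\mathbb{C}^N$, with sparsity $KN$ (that is, it is $KN$-sparse with respect to the canonical basis).
   Context: $\mathbb{Z}_N=\{0,1,\dots,N-1\}$ with arithmetic modulo $N$; vectors in $\mathbb{C}^N$ are indexed by $\mathbb{Z}_N$, and all index operations are modulo $N$. Difference set: a nonempty subset $\mathcal{K}=\{u_1,\dots,u_K\}\subseteq\mathbb{Z}_N$ with $K$ elements is an $(N,K,\lambda)$ difference set if the $K(K-1)$ differences $(u_k-u_l)\bmod N$, $k\ne l$, take all nonzero values $1,2,\dots,N-1$, each exactly $\lambda$ times. $\chi_{\mathcal{K}}\in\mathbb{C}^N$ is the characteristic function of $\mathcal{K}$: $\chi_{\mathcal{K}}(j)=1$ if $j\in\mathcal{K}$ and $0$ otherwise. Modulation and translation operators on $\mathbb{C}^N$: $(M_jg)(n)=e^{2\pi i jn/N}g(n)$ and $(T_kg)(n)=g(n-k)$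 for $n=0,\dots,N-1$. The subspace $\mathcal{W}_i$ is also described as the space of all $x\in\mathbb{C}^N$ with $\operatorname{supp}(x)\subseteq\mathcal{K}+i$. Fusion frames: a family of subspaces $\{\mathcal{W}_i\}_{i=1}^M$ of $\mathbb{C}^N$ is a fusion frame (all weights equal to one) if there exist $0<A\le B<\infty$ with $A\|x\|_2^2\le\sum_i\|P_ix\|_2^2\le B\|x\|_2^2$ for all $x\in\mathbb{C}^N$, where $P_i$ is the orthogonal projection onto $\mathcal{W}_i$; it is tight if $A=B$ is possible. Sparsity: let $\{\mathcal{W}_i\}_{i=1}^M$ be a fusion frame for $\mathbb{C}^N$ with $\dim\mathcal{W}_i=m_i$, and let $\{v_j\}_{j=1}^N$ be an orthonormal basis of $\mathbb{C}^N$. If for each $i$ there exists an orthonormal basis $\{\phi_{i,\ell}\}_{\ell=1}^{m_i}$ of $\mathcal{W}_i$ such that for each $\ell$ there exists a subset $J_{i,\ell}\subset\{1,\dots,N\}$ with $\phi_{i,\ell}\in\operatorname{span}\{v_j: j\in J_{i,\ell}\}$ and $\sum_{i=1}^M\sum_{\ell=1}^{m_i}|J_{i,\ell}|=k$, then $\{\phi_{i,\ell}\}_{i,\ell}$ is called an associated $k$-sparse frame. The fusion frame is called $k$-sparse with respect to $\{v_j\}_{j=1}^N$ if it has an associated $k$-sparse frame and if, for any associated $j$-sparse frame, $k\le j$. Optimal sparsity: let $\mathcal{FF}$ be a class of fusion frames for $\mathbb{C}^N$, $\{\mathcal{W}_i\}_{i=1}^M\in\mathcal{FF}$, and $\{v_j\}_{j=1}^N$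 an orthonormal basis of $\mathbb{C}^N$. Then $\{\mathcal{W}_i\}_{i=1}^M$ is optimally sparse in $\mathcal{FF}$ with respect to $\{v_j\}_{j=1}^N$ if it is $k_1$-sparse with respect to $\{v_j\}_{j=1}^N$ and there is no fusion frame $\{\mathcal{V}_i\}_{i=1}^M\in\mathcal{FF}$ that is $k_2$-sparse with respect to $\{v_j\}_{j=1}^N$ with $k_2<k_1$. *)

(* Defs.v *)
From mathcomp Require Import all_boot all_order all_algebra.
From mathcomp Require Import complex.
From mathcomp Require Import reals trigo.

Set Implicit Arguments.
Unset Strict Implicit.
Unset Printing Implicit Defensive.

Import Order.TTheory GRing.Theory Num.Theory.

Local Open Scope ring_scope.
Local Open Scope complex_scope.

(* A subspace of C^N is given by a matrix, of which only the row space matters.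
   A family of vectors is given by the rows of a matrix. *)

Section FusionFrames.
Context {R : realType} {M N : nat}.
Implicit Types (W : 'I_M -> 'M[R[i]]_N) (V : 'M[R[i]]_N) (A B : R) (k : nat).

Definition norm2sq (x : 'rV[R[i]]_N) : R[i] := dotmx x x.

Definition fusion_frame_bounds W A B : Prop :=
  [/\ 0 < A, A <= B &
      forall x : 'rV[R[i]]_N,
        A%:C * norm2sq x <= \sum_(i < M) norm2sq (x *m proj_ortho (W i))
          <= B%:C * norm2sq x].

Definition fusion_frame W : Prop := exists A B, fusion_frame_bounds W A B.

Definition tight_fusion_frame W : Prop := exists A, fusion_frame_bounds W A A.

(* Row l of [Phi i] is the l-th vector of an orthonormal basis of [W i];
   the rows of V form the reference orthonormal basis. *)
Definition associated_sparse_frame W V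
    (Phi : forall i, 'M[R[i]]_(\rank (W i), N)) k : Prop :=
  (forall i, Phi i \is unitarymx /\ (Phi i :=: W i)%MS) /\
  exists J : forall i, 'I_(\rank (W i)) -> {set 'I_N},
    (forall i l, (row l (Phi i) <= \sum_(j in J i l) <<row j V>>)%MS) /\
    (\sum_(i < M) \sum_(l < \rank (W i)) #|J i l|)%N = k.

Definition sparse W V k : Prop :=
  [/\ fusion_frame W, V \is unitarymx,
      exists Phi, @associated_sparse_frame W V Phi k &
      forall Phi j, @associated_sparse_frame W V Phi j -> (k <= j)%N].

Definition optimally_sparse (FF : ('I_M -> 'M[R[i]]_N) -> Prop) W V : Prop :=
  FF W /\
  exists k1, sparse W V k1 /\
    ~ exists W' k2, [/\ FF W', sparse W' V k2 & (k2 < k1)%N].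

Definition tight_fusion_frames_of_dim (m : nat) W : Prop :=
  tight_fusion_frame W /\ forall i, \rank (W i) = m.

End FusionFrames.

(* Z_N is 'I_N with N = n.+1, whose + and - are the modular operations of
   zmodp; unlike 'Z_N this is also correct for N = 1. *)

Section Gabor.
Context {R : realType} {n : nat}.
Implicit Types (D : {set 'I_n.+1}) (g : 'rV[R[i]]_n.+1).

Definition difference_set D (K lam : nat) : Prop :=
  [/\ D != set0, #|D| = K &
      forall d : 'I_n.+1, d != 0 ->
        #|[set p in setX D D | (p.1 != p.2) && (p.1 - p.2 == d)]| = lam].

Definition char_vec D : 'rV[R[i]]_n.+1 := \row_j (j \in D)%:R.

Definition expi (t : R) : R[i] := cos t +i* sin t.

Definition modulation (j : 'I_n.+1) g : 'rV[R[i]]_n.+1 :=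
  \row_m (expi (2 * pi * j%:R * m%:R / n.+1%:R) * g 0 m).

Definition translation (k : 'I_n.+1) g : 'rV[R[i]]_n.+1 :=
  \row_m g 0 (m - k).

Definition gabor_vec D : 'rV[R[i]]_n.+1 :=
  (Num.sqrt (#|D|%:R : R))^-1%:C *: char_vec D.

(* The span of the M_j T_i v, as j varies, is the row space. *)
Definition gabor_subspace D (i : 'I_n.+1) : 'M[R[i]]_n.+1 :=
  \matrix_(j < n.+1) modulation j (translation i (gabor_vec D)).

End Gabor.

(* Main.v *)
Require Import Defs.
From mathcomp Require Import all_boot all_order all_algebra.
From mathcomp Require Import complex.
From mathcomp Require Import reals trigo.
From mathcomp Require Import lra.

(** For fixed i the vectors M_j T_i v are the rows of the Fourier matrix times
    the diagonal matrix of T_i v.  The Fourier matrix is a Vandermonde matrix on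
    the N distinct N-th roots of unity, hence invertible, so multiplying by it
    on the left does not change the row space; and the diagonal matrix is a
    nonzero multiple of the coordinate projection onto the translate D + i.
    Thus W_i is the space of vectors supported in D + i
    ([gabor_subspace_eqmx]).

    Everything follows from this description.  The orthogonal projection onto
    W_i is the coordinate projection, and every coordinate m lies in exactly
    K = #|D| of the translates, so the squared norms of the projections of x
    add up to K times that of x: the frame is tight with bound K
    ([coord_tight_fusion_frame]).  The standard basis vectors indexed by D + i
    form an orthonormal basis of W_i, each of them using one reference vector,
    which gives an associated frame of sparsity K * N
    ([coord_associated_sparse_frame]).  Nothing can be sparser: in any fusion
    frame of N subspaces of dimension K there are K * N basis vectors, none of
    them is zero, and so each needs at least one reference vector
    ([sparsity_ge_dim]). *)

Set Implicit Arguments.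
Unset Strict Implicit.
Unset Printing Implicit Defensive.

Import Order.TTheory GRing.Theory Num.Theory.

Local Open Scope ring_scope.
Local Open Scope complex_scope.
Local Open Scope sesquilinear_scope.

Section CoordinateSubspaces.
Context {C : numClosedFieldType} {N : nat}.
Implicit Types (E : {set 'I_N}) (x : 'rV[C]_N).

Definition coordmx E : 'M[C]_N := diag_mx (\row_m (m \in E)%:R).

Lemma mul_coordmxE x E : x *m coordmx E = \row_m (x 0 m *+ (m \in E)).
Proof.
by apply/rowP => m; rewrite mul_mx_diag !mxE mulr_natr.
Qed.

Lemma coordmx_adj E : (coordmx E)^t* = coordmx E.
Proof.
rewrite tr_diag_mx; apply/matrixP => i j; rewrite !mxE.
by rewrite rmorphMn rmorph_nat.
Qed.

Lemma coordmx_setC E : coordmx (~: E) = 1%:M - coordmx E.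
Proof.
apply/matrixP => i j; rewrite !mxE !inE -mulrnBl.
by case: (i \in E); rewrite ?subrr ?subr0.
Qed.

Lemma coordmx_setC_orthogonal E : coordmx (~: E) *m coordmx E = 0.
Proof.
rewrite mulmx_diag; apply/matrixP => i j; rewrite !mxE inE.
by case: (i \in E); rewrite ?mulr0 ?mul0r mul0rn.
Qed.

(** The parts of x inside and outside E are handled separately: the former is in
    the row space of U, the latter is orthogonal to it. *)
Lemma mul_proj_ortho_coord p (U : 'M[C]_(p, N)) E x :
  (U :=: coordmx E)%MS -> x *m proj_ortho U = x *m coordmx E.
Proof.
move=> eqU.
have {1}-> : x = x *m coordmx E + x *m coordmx (~: E).
  by rewrite coordmx_setC mulmxBr mulmx1 addrC subrK.
rewrite mulmxDl proj_ortho_id ?eqU ?submxMl // proj_ortho_0; last first.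
  have /submxP[B ->] : (U <= coordmx E)%MS by rewrite eqU.
  apply/orthomx1P; rewrite trmx_mul map_mxM coordmx_adj.
  by rewrite mulmxA -[x *m _ *m _]mulmxA coordmx_setC_orthogonal mulmx0 mul0mx.
by rewrite addr0.
Qed.

(** The number of rows r is only propositionally equal to #|E|, because a basis
    of W must be indexed by the ordinals below \rank W. *)
Definition coord_basis r E (e : r = #|E|) : 'M[C]_(r, N) :=
  \matrix_l delta_mx 0 (enum_val (cast_ord e l)).

Lemma coord_basis_unitary r E (e : r = #|E|) : coord_basis e \is unitarymx.
Proof.
apply/row_unitarymxP => i j; rewrite !rowK dotmxE mxE.
rewrite (bigD1 (enum_val (cast_ord e i))) //= big1 ?addr0 => [|m nm].
  rewrite !mxE !eqxx mul1r (inj_eq enum_val_inj) (inj_eq (@cast_ord_inj _ _ e)).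
  by rewrite /= conjC_nat.
by rewrite !mxE (negPf nm) mul0r.
Qed.

Lemma coord_basis_eqmx r E (e : r = #|E|) :
  (coord_basis e :=: coordmx E)%MS.
Proof.
apply/eqmxP/andP; split; apply/row_subP => i.
  rewrite rowK; set m := enum_val _.
  suff -> : (delta_mx 0 m : 'rV[C]_N) = delta_mx 0 m *m coordmx E by rewrite submxMl.
  rewrite mul_coordmxE; apply/rowP => k; rewrite !mxE eqxx /=.
  by case: (k =P m) => [->|_]; rewrite ?enum_valP ?mul0rn.
case iE : (i \in E); last first.
  suff -> : row i (coordmx E) = 0 by rewrite sub0mx.
  by apply/rowP => k; rewrite !mxE iE mul0rn.
have -> : row i (coordmx E) =
    row (cast_ord (esym e) (enum_rank_in iE i)) (coord_basis e).
  rewrite rowK cast_ord_comp cast_ord_id enum_rankK_in //.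
  by apply/rowP => k; rewrite !mxE eqxx eq_sym /= iE.
exact: row_sub.
Qed.

Lemma rank_coordmx E : \rank (coordmx E) = #|E|.
Proof.
by rewrite -(coord_basis_eqmx (erefl #|E|)) mxrank_unitary ?coord_basis_unitary.
Qed.

End CoordinateSubspaces.

Section CoordinateFusionFrames.
Context {R : realType} {M N : nat}.
Implicit Types (W : 'I_M -> 'M[R[i]]_N) (E : 'I_M -> {set 'I_N}).

Lemma norm2sqE (x : 'rV[R[i]]_N) : norm2sq x = \sum_m `|x 0 m| ^+ 2.
Proof.
by rewrite /norm2sq dotmxE mxE; apply: eq_bigr => m _; rewrite !mxE normCK.
Qed.

(** Double counting: exchanging the sum over subspaces with the sum over
    coordinates, the term |x_m|^2 appears once for each E i that contains m. *)
Lemma coord_tight_fusion_frame W E K :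
  (forall i, W i :=: coordmx (E i))%MS ->
  (0 < K)%N -> (forall m, #|[set i | m \in E i]| = K) ->
  tight_fusion_frame W.
Proof.
move=> eqW K_gt0 cardE; exists K%:R; split; rewrite ?ltr0n // => x.
suff -> : \sum_(i < M) norm2sq (x *m proj_ortho (W i)) =
    (K%:R : R)%:C * norm2sq x by rewrite lexx.
under eq_bigr => i _ do
  rewrite (mul_proj_ortho_coord _ (eqW i)) mul_coordmxE norm2sqE.
rewrite exchange_big norm2sqE mulr_sumr /=; apply: eq_bigr => m _.
rewrite rmorph_nat mulr_natl -(cardE m) -sumr_const.
rewrite [RHS]big_mkcond /=; apply: eq_bigr => i _.
by rewrite mxE inE; case: (m \in E i); rewrite ?mulr1n // normr0 expr0n.
Qed.

Lemma coord_associated_sparse_frame W E :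
  (forall i, W i :=: coordmx (E i))%MS ->
  exists Phi, @associated_sparse_frame R M N W 1%:M Phi (\sum_i #|E i|).
Proof.
move=> eqW.
have rW i : \rank (W i) = #|E i| by rewrite eqW rank_coordmx.
exists (fun i => coord_basis (rW i)); split=> [i|].
  split; first exact: coord_basis_unitary.
  exact: eqmx_trans (coord_basis_eqmx _) (eqmx_sym (eqW i)).
exists (fun i l => [set enum_val (cast_ord (rW i) l)]); split=> [i l|].
  by rewrite big_set1 genmxE row1 rowK.
apply: eq_bigr => i _; under eq_bigr do rewrite cards1.
by rewrite sum1_card card_ord rW.
Qed.

(** A unit vector is nonzero, so it does not lie in the span of an empty
    family; hence each J i l has at least one element. *)
Lemma sparsity_ge_dim W V Phi k m :
  @associated_sparse_frame R M N W V Phi k -> (forall i, \rank (W i) = m) ->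
  (m * M <= k)%N.
Proof.
move=> [PhiP [J [JP <-]]] rW.
have -> : (m * M = \sum_(i < M) \sum_(l < \rank (W i)) 1)%N.
  under eq_bigr => i _ do rewrite sum1_card card_ord rW.
  by rewrite sum_nat_const card_ord mulnC.
apply: leq_sum => i _; apply: leq_sum => l _.
rewrite card_gt0; apply/eqP => J0.
have := JP i l; rewrite J0 big_set0 submx0 => /eqP row0.
have [/row_unitarymxP/(_ l l)] := PhiP i.
by rewrite row0 linear0l eqxx => /esym/eqP; rewrite oner_eq0.
Qed.

End CoordinateFusionFrames.

Section GaborSubspaces.
Context {R : realType} {n : nat}.
Implicit Types (D : {set 'I_n.+1}) (i : 'I_n.+1).

Lemma expiX (t : R) j : expi (t *+ j) = expi t ^+ j.
Proof.
elim: j => [|j IHj]; first by rewrite mulr0n /expi cos0 sin0 expr0.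
by rewrite mulrSr exprSr -IHj /expi cosD sinD; simpc; congr (_ +i* _); lra.
Qed.

(** By the double angle formula, 1 - cos t = 2 sin (t / 2) ^ 2, and t / 2 lies
    in ]0, pi[, where the sine is positive. *)
Lemma cos_lt1 (t : R) : 0 < t < 2 * pi -> cos t < 1.
Proof.
move=> /andP[t0 t2].
have s : 0 < sin (t / 2) by apply: sin_gt0_pi; lra.
have -> : t = (t / 2) *+ 2 by lra.
rewrite cos_mulr2n cos2sin2 -subr_gt0.
have := exprn_gt0 2 s; lra.
Qed.

(** If expi s = expi t then cos (t - s) = cos s ^ 2 + sin s ^ 2 = 1, which
    [cos_lt1] excludes when 0 < t - s < 2 pi. *)
Lemma expi_inj : {in `[0, 2 * pi[ &, injective (@expi R)}.
Proof.
have main (s t : R) : 0 <= s -> t < 2 * pi -> s < t -> expi s <> expi t.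
  move=> s0 t2 st [eqc eqs].
  have : cos (t - s) < 1 by apply: cos_lt1; lra.
  by rewrite cosB -eqc -eqs -!expr2 cos2Dsin2 ltxx.
move=> s t; rewrite !in_itv /= => /andP[s0 s2] /andP[t0 t2] eq_st.
case: (ltgtP s t) => // lt_st.
  by case: (main s t s0 t2 lt_st).
by case: (main t s t0 s2 lt_st).
Qed.

Definition root_nodes : 'rV[R[i]]_n.+1 :=
  \row_m expi (2 * pi * m%:R / n.+1%:R).

Lemma root_nodes_inj : injective (root_nodes 0).
Proof.
have pos : 0 < n.+1%:R :> R by rewrite ltr0n.
have range (m : 'I_n.+1) : 2 * pi * m%:R / n.+1%:R \in `[0, (2 * pi : R)[.
  rewrite in_itv /= divr_ge0 ?mulr_ge0 ?pi_ge0 ?ler0n //=.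
  by rewrite ltr_pdivrMr // ltr_pM2l ?mulr_gt0 ?pi_gt0 // ltr_nat.
move=> k m; rewrite !mxE => /(expi_inj (range k) (range m)).
move/(divIf (lt0r_neq0 pos)).
have /lt0r_neq0 pi2 : 0 < 2 * pi :> R by rewrite mulr_gt0 ?pi_gt0.
by move=> /(mulfI pi2) /eqP; rewrite eqr_nat => /eqP /val_inj.
Qed.

Lemma fourier_unit : Vandermonde n.+1 root_nodes \in unitmx.
Proof.
rewrite unitmxE det_Vandermonde unitfE.
apply/prodf_neq0 => k _; apply/prodf_neq0 => m lt_km.
rewrite subr_eq0; apply: contraTneq lt_km => /root_nodes_inj ->.
by rewrite ltnn.
Qed.

(** The phase of the (j, m) entry is the j-th power of the m-th root of unity,
    which is what makes the modulation matrix a Vandermonde matrix. *)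
Lemma gabor_subspace_factor D i :
  @gabor_subspace R n D i =
    Vandermonde n.+1 root_nodes *m diag_mx (translation i (gabor_vec D)).
Proof.
apply/matrixP => j m; rewrite mul_mx_diag !mxE -expiX; congr (expi _ * _).
by rewrite -[RHS]mulr_natr [RHS]mulrAC; congr (_ / _); exact: mulrAC.
Qed.

Definition translate D i : {set 'I_n.+1} := [set m | m - i \in D].

Lemma card_translate D i : #|translate D i| = #|D|.
Proof.
have -> : translate D i = (fun m => m - i) @^-1: D.
  by apply/setP => m; rewrite !inE.
exact/card_preimset/addIr.
Qed.

(** The translates that contain m are those by m - d with d in D. *)
Lemma translate_cover D m : #|[set i | m \in translate D i]| = #|D|.
Proof.
have -> : [set i | m \in translate D i] = (fun i => m - i) @^-1: D.
  by apply/setP => i; rewrite !inE.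
exact/card_preimset/(inj_comp (addrI m) oppr_inj).
Qed.

(** The Fourier matrix is invertible and the normalization of v is a nonzero
    scalar, so neither affects the row space; the scalar is nonzero because D
    is nonempty. *)
Lemma gabor_subspace_eqmx D i : D != set0 ->
  (@gabor_subspace R n D i :=: coordmx (translate D i))%MS.
Proof.
move=> D0; rewrite gabor_subspace_factor.
apply: eqmx_trans (eqmxMfull _ _) _; first by rewrite row_full_unit fourier_unit.
set c : R[i] := (Num.sqrt (#|D|%:R : R))^-1%:C.
have c0 : c != 0.
  by rewrite fmorph_eq0 invr_eq0 sqrtr_eq0 -ltNge ltr0n card_gt0.
suff -> : diag_mx (translation i (gabor_vec D)) = c *: coordmx (translate D i).
  exact: eqmx_scale.
by apply/matrixP => j m; rewrite !mxE inE [RHS]mulrnAr.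
Qed.

End GaborSubspaces.

Theorem theorem3p10 (R : realType) (n K lam : nat) (D : {set 'I_n.+1})
    (hD : difference_set D K lam) :
  let W := @gabor_subspace R n D in
  @optimally_sparse R n.+1 n.+1 (tight_fusion_frames_of_dim K) W 1%:M /\
  sparse W 1%:M (K * n.+1).
Proof.
move=> W; have [D0 cardD _] := hD.
have eqW i : (W i :=: coordmx (translate D i))%MS by exact: gabor_subspace_eqmx.
have K_gt0 : (0 < K)%N by rewrite -cardD card_gt0.
have tightW : tight_fusion_frame W.
  by apply: coord_tight_fusion_frame eqW K_gt0 _ => m; rewrite translate_cover.
have rankW i : \rank (W i) = K by rewrite eqW rank_coordmx card_translate.
have sparseW : sparse W 1%:M (K * n.+1).
  split.
  - by have [A bW] := tightW; exists A, A.
  - by apply/unitarymxP; rewrite trmx1 map_mx1 mulmx1.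
  - have [Phi PhiP] := coord_associated_sparse_frame eqW; exists Phi.
    suff -> : (K * n.+1 = \sum_i #|translate D i|)%N by [].
    under eq_bigr do rewrite card_translate cardD.
    by rewrite sum_nat_const card_ord mulnC.
  - by move=> Phi j /sparsity_ge_dim; apply.
split=> //; split; first by split.
exists (K * n.+1)%N; split=> // -[W' [k [[_ rankW'] [_ _ [Phi PhiP] _]]]].
by rewrite ltnNge (sparsity_ge_dim PhiP rankW').
Qed.
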